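(* Let $n\ge 1$, $\varepsilon\in(0,1]$, let $V\in S^{-\varepsilon}(\mathbb{R}^n)$ be real-valued, $H_0=-\Delta$, $H=H_0+V$, and let $$V_j=\sum_{\|J\|=j}(-1)^{|J|}V_J,\quad j\ge0,$$ with the operators $V_J$ defined in the context. Then the operators $V_j$ satisfy the recurrent relation $$V_0=I,\qquad V_j=V_{j-1}V+[V_{j-1},H_0]\quad(j\ge1),$$ and are given explicitly by $$V_j=\sum_{k=0}^j(-1)^k\binom jk H_0^kH^{j-k},\quad j\ge0.$$ Moreover, for $j\ge1$, $$V_j=\sum_{|\nu|\le j-1}p_\nu(x)\partial_x^\nu\quad\text{with}\quad p_\nu\in S^{-\varepsilon j}(\mathbb{R}^n).$$
   Context: For $\rho\ge 0$, $S^{-\rho}(\mathbb{R}^n)$ is the set of $p\in C^\infty(\mathbb{R}^n)$ with $|\partial^\nu p(x)|\le C_\nu(1+|x|)^{-\rho-|\nu|}$ on $\mathbb{R}^n$ for every multi-index $\nu$. All operators here are differential operators with smooth coefficients; $V$ also denotes multiplication by $V$, and $[P,Q]=PQ-QP$. For a finite (possibly empty) vector $J=(j_1,\ldots,j_k)$ with nonnegative integer components, put $|J|=j_1+\cdots+j_k$ and $\|J\|=|J|+k$ (so $\|J\|=0$ only for the empty vector). Operators $V_J$ are defined inductively: $V_J=I$ if $J$ is empty, and for nonempty $J=(j_1,\ldots,j_k)$, $$V_J=(\mathrm{ad}\,H_0)^{j_k}\left(V_{(j_1,\ldots,j_{k-1})}V\right),$$ where $V_{(j_1,\ldots,j_{k-1})}=I$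 if $k=1$, and $(\mathrm{ad}\,H_0)A=[H_0,A]=H_0A-AH_0$. *)

(* Defs.v *)
From HB Require Import structures.
From mathcomp Require Import all_boot all_order all_algebra.
From mathcomp Require Import all_classical all_reals all_analysis.
From mathcomp Require Import complex.

Set Implicit Arguments.
Unset Strict Implicit.
Unset Printing Implicit Defensive.
Import Order.TTheory GRing.Theory Num.Theory.
Import numFieldNormedType.Exports.
Local Open Scope ring_scope.
Local Open Scope complex_scope.

(* The library norm `|x| on 'rV[R]_n is the sup norm. *)
Definition euclid (R : realType) (n : nat) (x : 'rV[R]_n) : R :=
  Num.sqrt (\sum_(i < n) x 0 i ^+ 2).

Definition rpartial (R : realType) (n : nat) (i : 'I_n)
    (g : 'rV[R]_n -> R) : 'rV[R]_n -> R :=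
  fun x => 'D_(delta_mx 0 i) g x.

(* Every iterated partial derivative, in any order of the directions, exists
   and is continuous. *)
Definition rsmooth (R : realType) (n : nat) (g : 'rV[R]_n -> R) : Prop :=
  forall s : seq 'I_n, let h := foldr (@rpartial R n) g s in
    continuous h /\ forall (i : 'I_n) (x : 'rV[R]_n), derivable h x (delta_mx 0 i).

Definition cfun (R : realType) (n : nat) : Type := 'rV[R]_n -> R[i].

(* R[i] carries no normed-space structure over R in the library, so
   differentiation is componentwise. *)
Definition partial (R : realType) (n : nat) (i : 'I_n) (u : cfun R n) : cfun R n :=
  fun x => rpartial i (fun y => complex.Re (u y)) x +i* rpartial i (fun y => complex.Im (u y)) x.

Definition smooth (R : realType) (n : nat) (u : cfun R n) : Prop :=
  rsmooth (fun y => complex.Re (u y)) /\ rsmooth (fun y => complex.Im (u y)).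

Definition mlen (n : nat) (nu : 'I_n -> nat) : nat := (\sum_(i < n) nu i)%N.

Definition mpartial (R : realType) (n : nat) (nu : 'I_n -> nat) (u : cfun R n) :
    cfun R n :=
  foldr (fun i w => iter (nu i) (partial i) w) u (enum 'I_n).

(* S^m(R^n) *)
Definition symbol (R : realType) (n : nat) (m : R) (p : cfun R n) : Prop :=
  smooth p /\
  forall nu : 'I_n -> nat, exists c : R, forall x : 'rV[R]_n,
    `|mpartial nu p x| <= (c * (1 + euclid x) `^ (m - (mlen nu)%:R))%:C.

(* Differential operators are identified with their action on smooth functions:
   an operator is a total map, and only its values on smooth functions matter
   (see op_eq). *)
Definition op (R : realType) (n : nat) : Type := cfun R n -> cfun R n.

Definition op_eq (R : realType) (n : nat) (A B : op R n) : Prop :=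
  forall u : cfun R n, smooth u -> forall x : 'rV[R]_n, A u x = B u x.

Definition opM (R : realType) (n : nat) (V : cfun R n) : op R n :=
  fun u x => V x * u x.

Definition opC (R : realType) (n : nat) (A B : op R n) : op R n :=
  fun u => A (B u).

Definition opD (R : realType) (n : nat) (A B : op R n) : op R n :=
  fun u x => A u x + B u x.

Definition comm (R : realType) (n : nat) (A B : op R n) : op R n :=
  fun u x => A (B u) x - B (A u) x.

Definition H0 (R : realType) (n : nat) : op R n :=
  fun u x => - \sum_(i < n) partial i (partial i u) x.

Definition H (R : realType) (n : nat) (V : cfun R n) : op R n :=
  opD (@H0 R n) (opM V).

(* For J = (j_1, ..., j_k): |J| is sumn J and ||J|| is |J| + k. *)
Definition vnorm (J : seq nat) : nat := (sumn J + size J)%N.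

(* foldl peels off the last entry:
   VJ V (rcons J j) = (ad H0)^j (VJ V J \o V). *)
Definition VJ (R : realType) (n : nat) (V : cfun R n) (J : seq nat) : op R n :=
  foldl (fun A j => iter j (comm (@H0 R n)) (opC A (opM V))) id J.

(* ||J|| = j forces at most j entries, each at most j, so the finite index
   ranges below lose no vector J. *)
Definition Vop (R : realType) (n : nat) (V : cfun R n) (j : nat) : op R n :=
  fun u x => \sum_(k < j.+1) \sum_(J : k.-tuple 'I_j.+1 |
                 vnorm [seq val i | i <- J] == j)
    (-1) ^+ sumn [seq val i | i <- J] * VJ V [seq val i | i <- J] u x.

(* Main.v *)
Require Import Defs.
From HB Require Import structures.
From mathcomp Require Import all_boot all_order all_algebra.
From mathcomp Require Import all_classical all_reals all_analysis.
From mathcomp Require Import complex ring.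

Set Implicit Arguments.
Unset Strict Implicit.
Unset Printing Implicit Defensive.
Import Order.TTheory GRing.Theory Num.Theory.
Import numFieldNormedType.Exports.
Local Open Scope ring_scope.
Local Open Scope complex_scope.

(** The recurrence is a statement about the words J: a nonempty J either ends
    in 0, and then V_J = V_{J'} V for a word J' of norm one less, or ends in
    a + 1, and then V_J = [H0, V_{J'}] where J' ends in a and again has norm
    one less and the opposite sign (norm_seqsS).  Summing over J gives
    V_{j+1} = V_j V + [V_j, H0] (VopS).  The right-hand side is also
    V_j H - H0 V_j, from which the binomial formula follows by Pascal's rule
    (Vop_binomial).

    For the last claim, consider the operators of order at most d with
    coefficients in S^m (symbol_op).  Composing with multiplication by an
    element of S^b keeps the order and turns m into m + b, by the Leibniz rule
    (symbol_op_mulr).  The commutator with H0 raises the order by one only: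
    the principal terms of p D^nu H0 and H0 p D^nu cancel and the remaining
    coefficients contain a derivative of p, hence lie in S^(m - 1)
    (symbol_op_comm_H0).  As eps <= 1, the decay of the coefficients
    improves by at least eps from V_j to V_{j+1}, while the order grows by at
    most one (symbol_op_Vop); for j = 0 the commutator vanishes, so that V_1 = V
    has order 0.

    Cancelling the principal terms, and bringing products of partial
    derivatives to multi-index form, requires partial derivatives to commute;
    this is obtained from the mean value theorem applied to the second
    difference of the function over a small parallelogram (second_difference,
    rpartialC). *)

(** * Smooth real functions and symmetry of second derivatives *)

Section RealCalculus.
Variables (R : realType) (n : nat).
Implicit Types (f g : 'rV[R]_n -> R) (x : 'rV[R]_n) (i j : 'I_n) (s : seq 'I_n).

Lemma rsmooth_unfold g : rsmooth g ->
  [/\ continuous g, forall i x, derivable g x (delta_mx 0 i)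
    & forall i, rsmooth (rpartial i g)].
Proof.
move=> sg; split=> [||i s]; [by have [] := sg [::]|by have [] := sg [::]|].
by have := sg (rcons s i); rewrite foldr_rcons.
Qed.

Lemma rsmooth_rpartial i g : rsmooth g -> rsmooth (rpartial i g).
Proof. by move/rsmooth_unfold=> [_ _]. Qed.

(** The principle behind all closure properties of smoothness: a class of
    functions stable under partial derivatives consists of smooth functions as
    soon as its members are continuous and differentiable. *)
Lemma rsmooth_coind (C : ('rV[R]_n -> R) -> Prop) :
  (forall g, C g -> [/\ continuous g, forall i x, derivable g x (delta_mx 0 i)
                      & forall i, C (rpartial i g)]) ->
  forall g, C g -> rsmooth g.
Proof.
move=> CP g Cg s; elim/last_ind: s g Cg => [|s i IH] g /CP[cg dg Cg];
  first by split.
rewrite foldr_rcons; apply: IH; exact: Cg.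
Qed.

Lemma rpartialD i f g : (forall x, derivable f x (delta_mx 0 i)) ->
  (forall x, derivable g x (delta_mx 0 i)) ->
  rpartial i (f + g) = rpartial i f + rpartial i g.
Proof. by move=> df dg; apply/funext => x; exact: deriveD. Qed.

Lemma rpartialN i f : (forall x, derivable f x (delta_mx 0 i)) ->
  rpartial i (- f) = - rpartial i f.
Proof. by move=> df; apply/funext => x; exact: deriveN. Qed.

Lemma rpartialM i f g : (forall x, derivable f x (delta_mx 0 i)) ->
  (forall x, derivable g x (delta_mx 0 i)) ->
  rpartial i (f * g) = f * rpartial i g + rpartial i f * g.
Proof.
move=> df dg; apply/funext => x.
by rewrite /rpartial deriveM// /GRing.scale/= [X in _ + X]mulrC.
Qed.

Lemma rsmooth_cst (a : R) : rsmooth (cst a : 'rV[R]_n -> R).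
Proof.
apply: (@rsmooth_coind (fun g => exists b, g = cst b)); last by exists a.
move=> _ [b ->]; split=> [x|i x|i].
- by apply: cvg_cst; exact: nbhs_filter.
- exact: derivable_cst.
- by exists 0; apply/funext => x; exact: derive_cst.
Qed.

(** The derivative of a product is a sum of products, so neither sums nor
    products of smooth functions form a class stable under derivatives on their
    own; closing under both operations at once does. *)
Inductive smooth_poly : ('rV[R]_n -> R) -> Prop :=
| SPbase f : rsmooth f -> smooth_poly f
| SPadd f g : smooth_poly f -> smooth_poly g -> smooth_poly (f + g)
| SPmul f g : smooth_poly f -> smooth_poly g -> smooth_poly (f * g).

Lemma smooth_poly_rsmooth g : smooth_poly g -> rsmooth g.
Proof.
move: g; apply: rsmooth_coind => g; elim=> {g}.
- by move=> f /rsmooth_unfold[cf df sf]; split=> // i; exact: SPbase.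
- move=> f g _ [cf df sf] _ [cg dg sg]; split=> [x|i x|i].
  + by apply: continuousD; [exact: cf|exact: cg].
  + exact: derivableD.
  + by rewrite rpartialD//; exact: SPadd.
- move=> f g Cf [cf df sf] Cg [cg dg sg]; split=> [x|i x|i].
  + by apply: continuousM; [exact: cf|exact: cg].
  + exact: derivableM.
  + by rewrite rpartialM//; apply: SPadd; exact: SPmul.
Qed.

Lemma rsmoothD f g : rsmooth f -> rsmooth g -> rsmooth (f + g).
Proof. by move=> ? ?; apply/smooth_poly_rsmooth/SPadd; exact: SPbase. Qed.

Lemma rsmoothM f g : rsmooth f -> rsmooth g -> rsmooth (f * g).
Proof. by move=> ? ?; apply/smooth_poly_rsmooth/SPmul; exact: SPbase. Qed.

Lemma rsmoothN f : rsmooth f -> rsmooth (- f).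
Proof.
move=> sf; rewrite (_ : - f = cst (-1) * f).
  by apply: rsmoothM; [exact: rsmooth_cst|exact: sf].
by apply/funext => x; rewrite -[LHS]mulN1r.
Qed.

Lemma derivable_line g x v :
  (forall y, derivable g y v) ->
  forall t, is_derive (t : R) 1 (fun t => g (x + t *: v)) ('D_v g (x + t *: v)).
Proof.
move=> dg t.
have E : (fun h : R => h^-1 *: (((fun t => g (x + t *: v)) \o shift t) (h *: 1) -
    g (x + t *: v))) =
  (fun h : R => h^-1 *: ((g \o shift (x + t *: v)) (h *: v) - g (x + t *: v))).
  apply/funext => h /=; congr (_ *: (g _ - _)).
  by rewrite -[X in X + t]/(h * 1) mulr1 scalerDl addrCA.
by split; [rewrite /derivable E; exact: dg|rewrite /derive E].
Qed.

Lemma mvt_line g x v (h : R) : 0 < h ->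
  (forall y, derivable g y v) ->
  exists2 t, 0 <= t <= h & g (x + h *: v) - g x = h * 'D_v g (x + t *: v).
Proof.
move=> h0 dg.
have dl := derivable_line x dg.
have [|t th] := @MVT_segment R (fun t => g (x + t *: v))
   (fun t => 'D_v g (x + t *: v)) 0 h (ltW h0) (fun t _ => dl t).
  apply: derivable_within_continuous => t _.
  by have [] := dl t.
by rewrite scale0r addr0 subr0 mulrC => ->; exists t.
Qed.

(** The right-hand side singles out the order of the two derivatives, while the
    left-hand side is symmetric in i and j: this is what makes the derivatives
    commute.  The mean value theorem is applied in the direction a to the
    difference of g in the direction b, and then in the direction b. *)
Lemma second_difference g i j x (h : R) : 0 < h -> rsmooth g ->
  let a : 'rV[R]_n := delta_mx 0 i in let b : 'rV[R]_n := delta_mx 0 j in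
  exists s t : R, [/\ 0 <= s <= h, 0 <= t <= h &
    g (x + h *: a + h *: b) - g (x + h *: a) - (g (x + h *: b) - g x) =
    h ^+ 2 * rpartial j (rpartial i g) (x + s *: a + t *: b)].
Proof.
move=> h0 sg a b.
have [_ dg sdg] := rsmooth_unfold sg.
have [_ dig _] := rsmooth_unfold (sdg i).
pose phi y := g (y + h *: b) - g y.
have dphi y : is_derive y a phi (rpartial i g (y + h *: b) - rpartial i g y).
  have -> : phi = (fun z => g (z + h *: b)) - g by [].
  suff ? : is_derive y a (fun z => g (z + h *: b)) (rpartial i g (y + h *: b)).
    have ? := derivableP (dg i y); exact: is_deriveB.
  have E : (fun k : R => k^-1 *: (((fun z => g (z + h *: b)) \o shift y) (k *: a) -
      g (y + h *: b))) =
    (fun k : R => k^-1 *: ((g \o shift (y + h *: b)) (k *: a) - g (y + h *: b))).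
    by apply/funext => k /=; rewrite addrA.
  by split; [rewrite /derivable E; exact: dg|rewrite /derive E].
have [s sh Es] := @mvt_line phi x a h h0
  (fun y => @ex_derive _ _ _ _ _ _ _ (dphi y)).
have [t th Et] := @mvt_line (rpartial i g) (x + s *: a) b h h0 (dig j).
exists s, t; split=> //.
rewrite -/(phi (x + h *: a)) -/(phi x) Es.
have /@derive_val -> := dphi (x + s *: a).
by rewrite Et mulrA expr2.
Qed.

(** Both mixed derivatives are continuous at x, and by second_difference they
    take a common value at suitable points of an arbitrarily small
    parallelogram at x. *)
Lemma rpartialC i j g : rsmooth g ->
  rpartial i (rpartial j g) = rpartial j (rpartial i g).
Proof.
move=> sg; apply/funext => x; apply/eqP; rewrite -subr_eq0 -normr_le0.
apply/ler_addgt0Pl => e e0; rewrite addr0.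
have [c1 _ _] := rsmooth_unfold (rsmooth_rpartial i (rsmooth_rpartial j sg)).
have [c2 _ _] := rsmooth_unfold (rsmooth_rpartial j (rsmooth_rpartial i sg)).
have e20 : 0 < e / 2 by rewrite divr_gt0.
have /cvgrPdist_lt/(_ _ e20) n1 := c1 x.
have /cvgrPdist_lt/(_ _ e20) n2 := c2 x.
have /nbhs_ballP[d /= d0 nd] := @filterI _ _ (nbhs_filter x) _ _ n1 n2.
pose a : 'rV[R]_n := delta_mx 0 i; pose b : 'rV[R]_n := delta_mx 0 j.
have ab0 : 0 < `|a| + `|b| + 1 by rewrite ltr_wpDl// addr_ge0.
pose h := d / (`|a| + `|b| + 1).
have h0 : 0 < h by rewrite divr_gt0.
have small (s t : R) : 0 <= s <= h -> 0 <= t <= h -> ball x d (x + s *: a + t *: b).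
  move=> /andP[s0 sh] /andP[t0 th].
  rewrite -ball_normE /= -addrA opprD addNKr normrN.
  apply: (@le_lt_trans _ _ (h * (`|a| + `|b|))).
    rewrite (le_trans (ler_normD _ _))// !normrZ !ger0_norm// mulrDr.
    by rewrite lerD// ler_wpM2r.
  rewrite -[ltRHS](@divfK _ (`|a| + `|b| + 1)) ?gt_eqF// -/h.
  by rewrite ltr_pM2l// ltrDl.
have [s [t [sh th Est]]] := second_difference i j x h0 sg.
have [t' [s' [th' sh' Ets]]] := second_difference j i x h0 sg.
have E : rpartial j (rpartial i g) (x + s *: a + t *: b) =
         rpartial i (rpartial j g) (x + s' *: a + t' *: b).
  apply: (@mulfI _ (h ^+ 2)); first by rewrite expf_neq0// gt_eqF.
  apply: etrans (esym Est) _.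
  have -> : x + s' *: a + t' *: b = x + t' *: b + s' *: a by rewrite addrAC.
  apply: etrans Ets.
  have -> : x + h *: delta_mx 0 j + h *: delta_mx 0 i = x + h *: a + h *: b.
    by rewrite addrAC.
  by ring.
have [_ H2] := nd _ (small _ _ sh th); have [H1 _] := nd _ (small _ _ sh' th').
rewrite E in H2; apply: le_trans (ler_distD _ _ _) _.
rewrite [leRHS]splitr; apply: lerD; apply: ltW; first exact: H1.
by rewrite distrC; exact: H2.
Qed.

End RealCalculus.

(** * Smooth complex functions *)

Section ComplexCalculus.
Variables (R : realType) (n : nat).
Implicit Types (u v : 'rV[R]_n -> R[i]) (i j : 'I_n) (s t : seq 'I_n).

Lemma ReD u v : (fun y => complex.Re ((u + v) y)) =
  (fun y => complex.Re (u y)) + (fun y => complex.Re (v y)).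
Proof. by apply/funext => y; rewrite /GRing.add/=; case: (u y); case: (v y). Qed.

Lemma ImD u v : (fun y => complex.Im ((u + v) y)) =
  (fun y => complex.Im (u y)) + (fun y => complex.Im (v y)).
Proof. by apply/funext => y; rewrite /GRing.add/=; case: (u y); case: (v y). Qed.

Lemma ReM u v : (fun y => complex.Re ((u * v) y)) =
  (fun y => complex.Re (u y)) * (fun y => complex.Re (v y)) -
  (fun y => complex.Im (u y)) * (fun y => complex.Im (v y)).
Proof.
apply/funext => y; rewrite -[(u * v) y]/(u y * v y).
by rewrite -[RHS]/(complex.Re (u y) * complex.Re (v y) -
  complex.Im (u y) * complex.Im (v y)); case: (u y); case: (v y).
Qed.

Lemma ImM u v : (fun y => complex.Im ((u * v) y)) =
  (fun y => complex.Re (u y)) * (fun y => complex.Im (v y)) +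
  (fun y => complex.Im (u y)) * (fun y => complex.Re (v y)).
Proof.
apply/funext => y; rewrite -[(u * v) y]/(u y * v y).
by rewrite -[RHS]/(complex.Re (u y) * complex.Im (v y) +
  complex.Im (u y) * complex.Re (v y)); case: (u y); case: (v y).
Qed.

Lemma smooth_partial i u : smooth u -> smooth (partial i u).
Proof. by case=> ? ?; split; apply: rsmooth_rpartial. Qed.

Lemma smooth_cst (a : R[i]) : smooth (cst a : 'rV[R]_n -> R[i]).
Proof. split; exact: rsmooth_cst. Qed.

Lemma smooth0 : smooth (0 : 'rV[R]_n -> R[i]).
Proof. exact: (smooth_cst 0). Qed.

Lemma smoothD u v : smooth u -> smooth v -> smooth (u + v).
Proof.
by case=> ru iu [rv iv]; split; rewrite ?ReD ?ImD; apply: rsmoothD;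
  [exact: ru|exact: rv|exact: iu|exact: iv].
Qed.

Lemma smoothM u v : smooth u -> smooth v -> smooth (u * v).
Proof.
case=> ru iu [rv iv]; split; rewrite ?ReM ?ImM.
  exact: (rsmoothD (rsmoothM ru rv) (rsmoothN (rsmoothM iu iv))).
exact: (rsmoothD (rsmoothM ru iv) (rsmoothM iu rv)).
Qed.

Lemma smooth_oppr u : smooth u -> smooth (- u).
Proof.
move=> su; rewrite (_ : - u = cst (-1) * u).
  by apply: smoothM; [exact: smooth_cst|exact: su].
by apply/funext => x; rewrite -[LHS]mulN1r.
Qed.

Lemma smooth_sum (I : Type) (r : seq I) (P : pred I) (F : I -> 'rV[R]_n -> R[i]) :
  (forall k, P k -> smooth (F k)) -> smooth (\sum_(k <- r | P k) F k).
Proof.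
by move=> sF; apply: big_ind; [exact: smooth0|exact: smoothD|exact: sF].
Qed.

Lemma rsmooth_derivable i (g : 'rV[R]_n -> R) : rsmooth g ->
  forall x, derivable g x (delta_mx 0 i).
Proof. by case/rsmooth_unfold => _ + _. Qed.

Lemma partialD i u v : smooth u -> smooth v ->
  partial i (u + v) = partial i u + partial i v.
Proof.
case=> ru iu [rv iv]; apply/funext => x; rewrite /partial ReD ImD.
by rewrite !rpartialD//; exact: rsmooth_derivable.
Qed.

Lemma partialM i u v : smooth u -> smooth v ->
  partial i (u * v) = partial i u * v + u * partial i v.
Proof.
case=> ru iu [rv iv]; apply/funext => x; rewrite {1}/partial ReM ImM.
have d := rsmooth_derivable.
have dM f g : rsmooth f -> rsmooth g ->
    forall x : 'rV[R]_n, derivable (f * g) x (delta_mx 0 i).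
  by move=> sf sg; apply/d/rsmoothM; [exact: sf|exact: sg].
rewrite (rpartialD (dM _ _ ru iv) (dM _ _ iu rv)).
rewrite (rpartialD (dM _ _ ru rv) (d i _ (rsmoothN (rsmoothM iu iv)))).
rewrite (rpartialN (dM _ _ iu iv)).
rewrite (rpartialM (d i _ ru) (d i _ rv)) (rpartialM (d i _ iu) (d i _ iv)).
rewrite (rpartialM (d i _ ru) (d i _ iv)) (rpartialM (d i _ iu) (d i _ rv)).
rewrite -[RHS]/(partial i u x * v x + u x * partial i v x) /partial.
rewrite -[X in X +i* _]/(
  complex.Re (u x) * rpartial i (fun y => complex.Re (v y)) x +
  rpartial i (fun y => complex.Re (u y)) x * complex.Re (v x) -
  (complex.Im (u x) * rpartial i (fun y => complex.Im (v y)) x +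
  rpartial i (fun y => complex.Im (u y)) x * complex.Im (v x))).
rewrite -[X in _ +i* X]/(
  complex.Re (u x) * rpartial i (fun y => complex.Im (v y)) x +
  rpartial i (fun y => complex.Re (u y)) x * complex.Im (v x) +
  (complex.Im (u x) * rpartial i (fun y => complex.Re (v y)) x +
  rpartial i (fun y => complex.Im (u y)) x * complex.Re (v x))).
case: (u x) (v x) => a b [c e] /=.
by congr (_ +i* _); ring.
Qed.

Lemma partial_cst i (a : R[i]) : partial i (cst a : 'rV[R]_n -> R[i]) = 0.
Proof.
apply/funext => x; rewrite /partial /rpartial.
by rewrite !derive_cst.
Qed.

Lemma partialC i j u : smooth u ->
  partial i (partial j u) = partial j (partial i u).
Proof.
case=> ru iu.
have E k l : partial k (partial l u) = fun x =>
    rpartial k (rpartial l (fun y => complex.Re (u y))) x +i*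
    rpartial k (rpartial l (fun y => complex.Im (u y))) x by [].
by rewrite !E (rpartialC i j ru) (rpartialC i j iu).
Qed.

End ComplexCalculus.

(* From here on, smoothness and derivatives enter through their algebraic
   properties only, never through difference quotients. *)
Local Opaque rpartial rsmooth partial smooth.

(** * Iterated partial derivatives and multi-indices *)

Section IteratedPartials.
Variables (R : realType) (n : nat).
Implicit Types (u v : 'rV[R]_n -> R[i]) (i j : 'I_n) (s t : seq 'I_n).

(** Lists of directions lend themselves to induction; partials_perm makes the
    order irrelevant, and mpartialE and mpartial_count translate between lists
    and multi-indices. *)
Definition partials s u : 'rV[R]_n -> R[i] := foldr (@partial R n) u s.

Lemma partials_cons i s u : partials (i :: s) u = partial i (partials s u).
Proof. by []. Qed.

Lemma smooth_partials s u : smooth u -> smooth (partials s u).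
Proof.
move=> su; elim: s => [|i s IH]; first exact: su.
by rewrite partials_cons; apply: smooth_partial.
Qed.

Lemma partialsD s u v : smooth u -> smooth v ->
  partials s (u + v) = partials s u + partials s v.
Proof.
move=> su sv; elim: s => [//|i s IH]; rewrite !partials_cons IH.
by apply: partialD; exact: smooth_partials.
Qed.

Lemma partials0 s : partials s 0 = 0.
Proof. by elim: s => [//|i s IH]; rewrite partials_cons IH; exact: partial_cst. Qed.

Lemma partialsN s u : smooth u -> partials s (- u) = - partials s u.
Proof.
move=> su; apply/eqP; rewrite -addr_eq0 -(partialsD s (smooth_oppr su) su).
by rewrite addNr partials0.
Qed.

Lemma partials_sum s (I : Type) (r : seq I) (P : pred I) (F : I -> 'rV[R]_n -> R[i]) :
  (forall k, P k -> smooth (F k)) ->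
  partials s (\sum_(k <- r | P k) F k) = \sum_(k <- r | P k) partials s (F k).
Proof.
move=> sF.
suff [_ E] : smooth (\sum_(k <- r | P k) F k) /\
   partials s (\sum_(k <- r | P k) F k) = \sum_(k <- r | P k) partials s (F k).
  by exact: E.
apply: (big_ind2 (fun a b => smooth a /\ partials s a = b)).
- by split; [exact: smooth0|exact: partials0].
- move=> a b c d [sa <-] [sc <-]; split; first exact: smoothD.
  exact: partialsD.
- by move=> k Pk; split=> [|//]; exact: sF.
Qed.

Lemma partial_partials i s u : smooth u ->
  partial i (partials s u) = partials s (partial i u).
Proof.
move=> su; elim: s => [//|j s IH].
by rewrite !partials_cons (partialC i j (smooth_partials s su)) IH.
Qed.

Lemma partials_cat s t u : partials (s ++ t) u = partials s (partials t u).
Proof. by rewrite /partials foldr_cat. Qed.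

Lemma partials_rcons s i u : partials (rcons s i) u = partials s (partial i u).
Proof. by rewrite -cats1 partials_cat. Qed.

Lemma partials_perm s t u : smooth u -> perm_eq s t -> partials s u = partials t u.
Proof.
move=> su; elim: s t => [|i s IH] t pst.
  by move: pst; rewrite perm_sym => /perm_nilP ->.
have : i \in t by rewrite -(perm_mem pst) mem_head.
move=> /path.splitPr def_t; case: def_t pst => t1 t2.
rewrite perm_sym (perm_catCA t1 [:: i]) perm_cons perm_sym => /IH IHt.
rewrite partials_cons IHt !partials_cat partials_cons.
by rewrite (partial_partials i t1 (smooth_partials t2 su)).
Qed.

Lemma mpartialE (nu : 'I_n -> nat) u :
  mpartial nu u = partials (flatten [seq nseq (nu i) i | i <- enum 'I_n]) u.
Proof.
rewrite /mpartial; elim: (enum 'I_n) => //= i r ->.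
by rewrite partials_cat; elim: (nu i) => //= k ->.
Qed.

Lemma mpartial_count s u : smooth u ->
  mpartial (fun i => count_mem i s) u = partials s u.
Proof.
move=> su; rewrite mpartialE; apply: partials_perm => //.
apply/allP => /= i _; rewrite count_flatten -map_comp sumnE big_map -/(count_mem i s).
rewrite big_enum/= (bigD1 i)//= big1 => [|j ji]; rewrite count_nseq/= ?eqxx ?mul1n ?addn0//.
by rewrite (negPf ji).
Qed.

Lemma size_multiindex (nu : 'I_n -> nat) :
  size (flatten [seq nseq (nu i) i | i <- enum 'I_n]) = mlen nu.
Proof.
rewrite size_flatten /shape -map_comp sumnE big_map big_enum/=.
by apply: eq_bigr => i _; rewrite /= size_nseq.
Qed.

Lemma mlen_count s : mlen (fun i : 'I_n => count_mem i s) = size s.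
Proof.
rewrite /mlen; elim: s => [|j s IH]; first by rewrite big1.
rewrite /= big_split/= IH (bigD1 j)//= eqxx big1 ?addn0 // => i ij.
by rewrite eq_sym (negPf ij).
Qed.

End IteratedPartials.

(** * Symbols *)

Section Symbols.
Variables (R : realType) (n : nat).
Implicit Types (p q u : 'rV[R]_n -> R[i]) (i : 'I_n) (s : seq 'I_n) (m a b : R).

Definition symbol_bound m p := exists c : R, forall x : 'rV[R]_n,
  `|p x| <= (c * (1 + euclid x) `^ m)%:C.

Lemma weight_ge1 (x : 'rV[R]_n) : 1 <= 1 + euclid x.
Proof. by rewrite lerDl sqrtr_ge0. Qed.

Lemma weight_gt0 (x : 'rV[R]_n) : 0 < 1 + euclid x.
Proof. exact: lt_le_trans (weight_ge1 x). Qed.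

Lemma symbol_boundW m m' p : m <= m' -> symbol_bound m p -> symbol_bound m' p.
Proof.
move=> mm' [c cP]; exists `|c| => x; apply: le_trans (cP x) _.
rewrite lecR; apply: (@le_trans _ _ (`|c| * (1 + euclid x) `^ m)).
  by rewrite ler_wpM2r ?powR_ge0// ler_norm.
by rewrite ler_wpM2l// ler_powR// weight_ge1.
Qed.

Lemma symbol_boundD m p q :
  symbol_bound m p -> symbol_bound m q -> symbol_bound m (p + q).
Proof.
move=> [c cP] [d dP]; exists (c + d) => x.
rewrite mulrDl rmorphD; apply: le_trans (ler_normD _ _) _.
by apply: lerD; [exact: cP|exact: dP].
Qed.

Lemma symbol_boundM a b p q :
  symbol_bound a p -> symbol_bound b q -> symbol_bound (a + b) (p * q).
Proof.
move=> [c cP] [d dP]; exists (c * d) => x.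
rewrite powRD ?(gt_eqF (weight_gt0 x)) ?implybT// mulrACA rmorphM.
rewrite [leLHS]normrM.
by apply: ler_pM; [exact: normr_ge0|exact: normr_ge0|exact: cP|exact: dP].
Qed.

Lemma symbolP m p : symbol m p <->
  smooth p /\ forall s, symbol_bound (m - (size s)%:R) (partials s p).
Proof.
split=> -[sp bp].
  split=> [//|s]; have [c cP] := bp (fun i => count_mem i s); exists c => x.
  by have := cP x; rewrite mpartial_count// mlen_count.
split=> [//|nu]; rewrite mpartialE -size_multiindex; exact: bp.
Qed.

Lemma symbol_smooth m p : symbol m p -> smooth p.
Proof. by case. Qed.

Lemma symbolW m m' p : m <= m' -> symbol m p -> symbol m' p.
Proof.
move=> mm' /symbolP[sp bp]; apply/symbolP; split=> [//|s].
by apply: symbol_boundW (bp s); rewrite lerD2r.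
Qed.

Lemma symbolD m p q : symbol m p -> symbol m q -> symbol m (p + q).
Proof.
move=> /symbolP[sp bp] /symbolP[sq bq]; apply/symbolP; split=> [|s].
  exact: smoothD.
by rewrite partialsD//; apply: symbol_boundD; [exact: bp|exact: bq].
Qed.

Lemma symbol_partial m i p : symbol m p -> symbol (m - 1) (partial i p).
Proof.
move=> /symbolP[sp bp]; apply/symbolP; split=> [|s]; first exact: smooth_partial.
have := bp (rcons s i); rewrite size_rcons partials_rcons.
by have -> : m - (size s).+1%:R = m - 1 - (size s)%:R by rewrite -natr1; ring.
Qed.

(** The induction on s applies the hypothesis to both products in
    p' q + p q', with one of the two orders lowered by one; this avoids
    the Leibniz formula of higher order. *)
Lemma symbolM a b p q : symbol a p -> symbol b q -> symbol (a + b) (p * q).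
Proof.
move=> Sp Sq; apply/symbolP; split=> [|s].
  by apply: smoothM; [exact: symbol_smooth Sp|exact: symbol_smooth Sq].
elim/last_ind: s a b p q Sp Sq => [|s i IH] a b p q Sp Sq.
  have /symbolP[_ /(_ [::])] := Sp; have /symbolP[_ /(_ [::])] := Sq.
  by rewrite /= !subr0 => ? ?; exact: symbol_boundM.
have [sp sq] := (symbol_smooth Sp, symbol_smooth Sq).
have [spi sqi] := (smooth_partial i sp, smooth_partial i sq).
rewrite partials_rcons partialM// partialsD; [|exact: smoothM|exact: smoothM].
rewrite size_rcons -natr1; apply: symbol_boundD.
  have -> : a + b - ((size s)%:R + 1) = a - 1 + b - (size s)%:R by ring.
  by apply: IH => //; exact: symbol_partial.
have -> : a + b - ((size s)%:R + 1) = a + (b - 1) - (size s)%:R by ring.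
by apply: IH => //; exact: symbol_partial.
Qed.

Lemma symbol_cst (z : R[i]) : symbol 0 (cst z : 'rV[R]_n -> R[i]).
Proof.
apply/symbolP; split=> [|s]; first exact: smooth_cst.
exists (complex.Re `|z|) => x; rewrite sub0r; case/lastP: s => [|s i].
  by rewrite oppr0 powRr0 mulr1 normc_def.
rewrite partials_rcons partial_cst partials0 normr0 ler0c.
by rewrite mulr_ge0 ?powR_ge0// normc_def sqrtr_ge0.
Qed.

Lemma symbol0 m : symbol m (0 : 'rV[R]_n -> R[i]).
Proof.
apply/symbolP; split=> [|s]; first exact: smooth0.
by exists 0 => x; rewrite partials0 normr0 mul0r.
Qed.

End Symbols.

(** * The words J of given norm *)

Section Combinatorics.

(** The double sum over lengths and tuples in Vop, flattened into one
    duplicate-free list: splitting the sum according to the last entry of J then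
    amounts to a permutation of lists. *)
Definition norm_seqs (j : nat) : seq (seq nat) :=
  [seq [seq val i | i <- J] | k : 'I_j.+1 <- enum 'I_j.+1,
     J : k.-tuple 'I_j.+1 <-
       enum [pred J : k.-tuple 'I_j.+1 | vnorm [seq val i | i <- J] == j]].

Lemma sum_norm_seqs (V : nmodType) (F : seq nat -> V) (j : nat) :
  \sum_(k < j.+1) \sum_(J : k.-tuple 'I_j.+1 | vnorm [seq val i | i <- J] == j)
    F [seq val i | i <- J] = \sum_(J <- norm_seqs j) F J.
Proof.
rewrite big_allpairs_dep big_enum/=; apply: eq_bigr => k _.
by rewrite big_enum.
Qed.

Lemma mem_norm_seqs (j : nat) (J : seq nat) : (J \in norm_seqs j) = (vnorm J == j).
Proof.
apply/allpairsPdep/eqP => [[k [t [_ + ->]]]|Jj].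
  by rewrite mem_enum inE => /eqP.
have sJ : (size J < j.+1)%N by rewrite ltnS -Jj leq_addl.
have JE : [seq val i | i <- [seq (inord k : 'I_j.+1) | k <- J]] = J.
  rewrite -map_comp map_id_in// => k kJ /=; rewrite inordK// ltnS -Jj.
  apply: leq_trans (leq_addr _ _).
  by rewrite sumnE (big_rem k)//= leq_addr.
exists (Ordinal sJ), (map_tuple (fun k => (inord k : 'I_j.+1)) (in_tuple J)).
by rewrite /= JE; split; rewrite ?mem_enum ?inE ?JE ?Jj.
Qed.

Lemma norm_seqs_uniq (j : nat) : uniq (norm_seqs j).
Proof.
apply: allpairs_uniq_dep => [|k _|]; try exact: enum_uniq.
move=> [k t] [l r] _ _ /= E.
have /ord_inj kl : k = l :> nat.
  by rewrite -(size_tuple t) -(size_tuple r) -(size_map val) E size_map.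
move: t E; rewrite kl => t E; congr Tagged.
by apply: val_inj; apply: inj_map E; exact: val_inj.
Qed.

Definition bump_last (J : seq nat) := rcons (take (size J).-1 J) (last 0 J).+1.

Lemma bump_last_rcons J a : bump_last (rcons J a) = rcons J a.+1.
Proof.
by rewrite /bump_last last_rcons size_rcons/= -[in take _ _]cats1 take_size_cat.
Qed.

Lemma vnorm_rcons J a : vnorm (rcons J a) = (vnorm J + a).+1.
Proof.
by rewrite /vnorm size_rcons -cats1 sumn_cat /= addn0 addnS addnAC.
Qed.

(** A word of norm j + 1 is nonempty; removing its last entry if that is 0, and
    decreasing it by one otherwise, leaves a word of norm j.  In the second
    case the word that is left is nonempty. *)
Lemma norm_seqsS (j : nat) : perm_eq (norm_seqs j.+1)
  ([seq rcons J 0 | J <- norm_seqs j] ++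
   [seq bump_last J | J <- norm_seqs j & J != [::]]).
Proof.
apply: uniq_perm; first exact: norm_seqs_uniq.
  rewrite cat_uniq !map_inj_in_uniq ?filter_uniq ?norm_seqs_uniq//=.
  - rewrite andbT; apply/hasPn => _ /mapP[J + ->]; rewrite mem_filter.
    case/lastP: J => // J a _; rewrite bump_last_rcons.
    by apply/mapP => -[K _ /rcons_inj[_]].
  - move=> J K; rewrite !mem_filter; case/lastP: J => // J a _.
    by case/lastP: K => // K b _; rewrite !bump_last_rcons => /rcons_inj[-> ->].
  - by move=> J K _ _ /rcons_inj[].
move=> J; rewrite mem_norm_seqs mem_cat; apply/eqP/orP.
  case/lastP: J => // J [|a]; rewrite vnorm_rcons ?addn0 ?addnS => -[vJ].
    by left; apply: map_f; rewrite mem_norm_seqs vJ.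
  right; rewrite -bump_last_rcons; apply: map_f.
  by rewrite mem_filter mem_norm_seqs vnorm_rcons vJ eqxx andbT -size_eq0 size_rcons.
case=> /mapP[K + ->]; rewrite ?mem_filter mem_norm_seqs.
  by move/eqP => <-; rewrite vnorm_rcons addn0.
case/lastP: K => // K a /andP[_ /eqP <-].
by rewrite bump_last_rcons !vnorm_rcons addnS.
Qed.

End Combinatorics.

(** * Operators with symbol coefficients *)

(** Read pk and wk as k-th derivatives of p and w: the left-hand side is the
    second derivative of p w minus p w2. *)
Lemma comm_leibniz (T : comPzRingType) (p p1 p2 w w1 w2 : T) :
  p2 * w + p1 * w1 + (p1 * w1 + p * w2) - p * w2 = p2 * w + (1 + 1) * p1 * w1.
Proof. ring. Qed.

Section SymbolOperators.
Variables (R : realType) (n : nat).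
Implicit Types (p q u : 'rV[R]_n -> R[i]) (i : 'I_n) (s t : seq 'I_n) (m a b : R).
Implicit Types (A B : op R n) (d : nat).

(** Equations hold on smooth functions only, in accordance with op_eq.  The
    entries of a multi-index of length at most d are less than d + 1, which
    accounts for the type of nu. *)
Definition symbol_op m d A := exists p : {ffun 'I_n -> 'I_d.+1} -> ('rV[R]_n -> R[i]),
  (forall nu, symbol m (p nu)) /\
  forall u, smooth u ->
    A u = \sum_(nu : {ffun 'I_n -> 'I_d.+1} | (mlen (fun i => nu i) <= d)%N)
            p nu * mpartial (fun i => nu i) u.

Lemma symbol_op_ext m d A B :
  (forall u, smooth u -> A u = B u) -> symbol_op m d B -> symbol_op m d A.
Proof.
by move=> AB [p [sp Bp]]; exists p; split=> [//|u su]; rewrite AB// Bp.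
Qed.

Lemma symbol_op0 m d : symbol_op m d (fun=> 0).
Proof.
exists (fun=> 0); split=> [nu|u su]; first exact: symbol0.
by rewrite big1// => nu _; rewrite mul0r.
Qed.

Lemma symbol_opD m d A B :
  symbol_op m d A -> symbol_op m d B -> symbol_op m d (fun u => A u + B u).
Proof.
move=> [p [sp Ap]] [q [sq Bq]]; exists (fun nu => p nu + q nu).
split=> [nu|u su]; first exact: symbolD.
by rewrite Ap// Bq// -big_split/=; apply: eq_bigr => nu _; rewrite mulrDl.
Qed.

Lemma symbol_op_sum m d (I : Type) (r : seq I) (P : pred I) (F : I -> op R n) :
  (forall k, P k -> symbol_op m d (F k)) ->
  symbol_op m d (fun u => \sum_(k <- r | P k) F k u).
Proof.
move=> SF; elim: r => [|k r IH].
  by apply: symbol_op_ext (symbol_op0 m d) => u _; rewrite big_nil.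
case Pk : (P k).
  apply: symbol_op_ext (symbol_opD (SF k Pk) IH) => u _.
  by rewrite big_cons Pk.
by apply: symbol_op_ext IH => u _; rewrite big_cons Pk.
Qed.

(** Introduction rule: coefficients may be attached to lists of directions, so
    that closure properties can be proved by induction on lists. *)
Lemma symbol_op_term m d p s : symbol m p -> (size s <= d)%N ->
  symbol_op m d (fun u => p * partials s u).
Proof.
move=> Sp sd.
pose nu0 : {ffun 'I_n -> 'I_d.+1} := [ffun i => inord (count_mem i s)].
have nu0E i : nu0 i = count_mem i s :> nat.
  by rewrite ffunE inordK// ltnS (leq_trans (count_size _ _)).
have nu0F : (fun i => nat_of_ord (nu0 i)) = (fun i => count_mem i s).
  by apply/funext.
exists (fun nu => if nu == nu0 then p else 0); split=> [nu|u su].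
  by case: ifP => _ //; exact: symbol0.
rewrite (bigD1 nu0)/=; last by rewrite nu0F mlen_count.
rewrite eqxx nu0F mpartial_count// big1 ?addr0// => nu /andP[_ /negPf ->].
by rewrite mul0r.
Qed.

(** The derivatives t already moved past q are what makes the induction on s go
    through: the last direction of s either hits q or joins t. *)
Lemma symbol_op_partials_mul a b d p q s t :
  symbol a p -> symbol b q -> (size s + size t <= d)%N ->
  symbol_op (a + b) d (fun u => p * partials s (q * partials t u)).
Proof.
move=> Sp; elim/last_ind: s t q => [|s i IH] t q Sq std.
  apply: symbol_op_ext (symbol_op_term (symbolM Sp Sq) std) => u su.
  exact: mulrA.
have Sqi : symbol b (partial i q).
  by apply: symbolW (symbol_partial i Sq); rewrite gerBl ler01.
rewrite size_rcons addSn in std.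
have H1 := IH t _ Sqi (ltnW std).
have H2 : symbol_op (a + b) d (fun u => p * partials s (q * partials (i :: t) u)).
  by apply: IH => //; rewrite addnS.
apply: symbol_op_ext (symbol_opD H1 H2) => u su.
have [sq st] := (symbol_smooth Sq, smooth_partials t su).
rewrite partials_rcons (partialM i sq st).
rewrite (partialsD s (smoothM (smooth_partial i sq) st)
  (smoothM sq (smooth_partial i st))).
by rewrite mulrDr partials_cons.
Qed.

Lemma symbol_op_mulr a b d q A : symbol b q -> symbol_op a d A ->
  symbol_op (a + b) d (fun u => A (q * u)).
Proof.
move=> Sq [p [sp Ap]].
pose F (nu : {ffun 'I_n -> 'I_d.+1}) : op R n :=
   fun u => p nu * mpartial (fun i => nu i) (q * u).
suff : symbol_op (a + b) d (fun u =>
    \sum_(nu : {ffun 'I_n -> 'I_d.+1} | (mlen (fun i => nu i) <= d)%N) F nu u).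
  by apply: symbol_op_ext => u su; rewrite (Ap _ (smoothM (symbol_smooth Sq) su)).
apply: symbol_op_sum => nu nud.
have H := @symbol_op_partials_mul a b d (p nu) q
  (flatten [seq nseq (nu i) i | i <- enum 'I_n]) [::].
apply: symbol_op_ext (H (sp nu) Sq _) => [u su|]; first by rewrite /F mpartialE.
by rewrite addn0 size_multiindex.
Qed.

Lemma symbol_opW m m' d d' A : m <= m' -> (d <= d')%N ->
  symbol_op m d A -> symbol_op m' d' A.
Proof.
move=> mm dd [p [sp Ap]].
pose F (nu : {ffun 'I_n -> 'I_d.+1}) : op R n :=
   fun u => p nu * mpartial (fun i => nu i) u.
apply: (@symbol_op_ext _ _ _ (fun u =>
    \sum_(nu : {ffun 'I_n -> 'I_d.+1} | (mlen (fun i => nu i) <= d)%N) F nu u)).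
  by move=> u su; rewrite Ap.
apply: symbol_op_sum => nu nud.
have := @symbol_op_term m' d' (p nu)
  (flatten [seq nseq (nu i) i | i <- enum 'I_n]) (symbolW mm (sp nu)).
rewrite size_multiindex => /(_ (leq_trans nud dd)).
by apply: symbol_op_ext => u su; rewrite /F mpartialE.
Qed.

Lemma H0E u : H0 u = - \sum_(i < n) partial i (partial i u).
Proof. by apply/funext => x; rewrite /H0 -[RHS]/(- _) fct_sumE. Qed.

Lemma smooth_H0 u : smooth u -> smooth (H0 u).
Proof.
move=> su; rewrite H0E; apply/smooth_oppr/smooth_sum => i _.
by do 2!apply: smooth_partial.
Qed.

Lemma H0D u v : smooth u -> smooth v -> H0 (u + v) = H0 u + H0 v.
Proof.
move=> su sv; rewrite !H0E -opprD -big_split/=; congr (- _).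
apply: eq_bigr => i _; rewrite (partialD i su sv).
exact: (partialD i (smooth_partial i su) (smooth_partial i sv)).
Qed.

Lemma H0Z (c : R[i]) u : smooth u -> H0 (cst c * u) = cst c * H0 u.
Proof.
move=> su; have pZ i w : smooth w -> partial i (cst c * w) = cst c * partial i w.
  by move=> sw; rewrite (partialM i (smooth_cst n c) sw) partial_cst mul0r add0r.
rewrite !H0E mulrN mulr_sumr; congr (- _).
by apply: eq_bigr => i _; rewrite (pZ i u su) (pZ i _ (smooth_partial i su)).
Qed.

Lemma H0_sum (I : Type) (r : seq I) (P : pred I) (F : I -> 'rV[R]_n -> R[i]) :
  (forall k, P k -> smooth (F k)) ->
  H0 (\sum_(k <- r | P k) F k) = \sum_(k <- r | P k) H0 (F k).
Proof.
move=> sF; elim: r => [|k r IH].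
  rewrite !big_nil H0E big1 ?oppr0// => i _.
  by rewrite (partial_cst i 0) (partial_cst i 0).
rewrite !big_cons; case: ifP => // Pk; rewrite H0D ?IH//; first exact: sF.
exact: smooth_sum.
Qed.

Lemma partials_H0 s u : smooth u -> partials s (H0 u) = H0 (partials s u).
Proof.
move=> su; have sd i : smooth (partial i (partial i u)).
  by do 2!apply: smooth_partial.
rewrite !H0E (partialsN s (smooth_sum _ (fun i _ => sd i))).
rewrite (partials_sum s _ (fun i _ => sd i)); congr (- _); apply: eq_bigr => i _.
by rewrite (partial_partials i s su) (partial_partials i s (smooth_partial i su)).
Qed.

(** With w = D^nu u, the term p D^nu contributes
    p D^nu H0 u - H0 (p D^nu u) = Laplacian (p w) - p Laplacian w, which is
    (Laplacian p) w + 2 (grad p, grad w). *)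
Lemma symbol_op_comm_H0 m d A : symbol_op m d A ->
  symbol_op (m - 1) d.+1 (comm A (@H0 R n)).
Proof.
move=> [p [sp Ap]].
pose F (nu : {ffun 'I_n -> 'I_d.+1}) i : op R n :=
   let s := flatten [seq nseq (nu i) i | i <- enum 'I_n] in
   fun u => partial i (partial i (p nu)) * partials s u +
      (cst 2 * partial i (p nu)) * partials (i :: s) u.
apply: (@symbol_op_ext _ _ _ (fun u =>
    \sum_(nu : {ffun 'I_n -> 'I_d.+1} | (mlen (fun i => nu i) <= d)%N)
     \sum_(i < n) F nu i u)); last first.
  apply: symbol_op_sum => nu nud; apply: symbol_op_sum => i _.
  apply: symbol_opD; apply: symbol_op_term; rewrite /= ?size_multiindex//.
  - apply: symbolW (symbol_partial i (symbol_partial i (sp nu))).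
    by rewrite gerBl ler01.
  - exact: leqW.
  - rewrite -[m - 1]add0r; apply: symbolM; first exact: symbol_cst.
    exact: symbol_partial.
move=> u su.
have sH := smooth_H0 su.
rewrite -[LHS]/(A (H0 u) - H0 (A u)) !Ap// H0_sum => [|nu _]; last first.
  apply: smoothM; first exact: symbol_smooth (sp nu).
  by rewrite mpartialE; exact: smooth_partials.
rewrite -sumrB; apply: eq_bigr => nu _.
have spn := symbol_smooth (sp nu).
rewrite !mpartialE partials_H0// /F; move: (flatten _) => s.
have sw := smooth_partials s su.
rewrite !H0E mulrN opprK addrC mulr_sumr -sumrB; apply: eq_bigr => i _.
have [sp1 sw1] := (smooth_partial i spn, smooth_partial i sw).
rewrite partials_cons (partialM i spn sw).
rewrite (partialD i (smoothM sp1 sw) (smoothM spn sw1)).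
rewrite (partialM i sp1 sw) (partialM i spn sw1).
exact: comm_leibniz.
Qed.

End SymbolOperators.

(** * The operators V_j *)

Section Vop.
Variables (R : realType) (n : nat) (V : 'rV[R]_n -> R[i]).
Hypothesis sV : smooth V.
Implicit Types (u v : 'rV[R]_n -> R[i]) (A B : op R n) (J : seq nat).

Definition additive_op A :=
  (forall u, smooth u -> smooth (A u)) /\
  (forall u v, smooth u -> smooth v -> A (u + v) = A u + A v).

Lemma additive_opC A B : additive_op A -> additive_op B -> additive_op (opC A B).
Proof.
move=> [sA dA] [sB dB]; split=> [u su|u v su sv]; first exact: sA (sB _ su).
by rewrite /opC dB// (dA _ _ (sB _ su) (sB _ sv)).
Qed.

Lemma additive_op_comm A B : additive_op A -> additive_op B -> additive_op (comm A B).
Proof.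
move=> aA aB; have [sAB dAB] := additive_opC aA aB.
have [sBA dBA] := additive_opC aB aA.
have commE u : comm A B u = opC A B u - opC B A u by [].
split=> [u su|u v su sv]; rewrite !commE.
  exact: (smoothD (sAB _ su) (smooth_oppr (sBA _ su))).
by rewrite (dAB _ _ su sv) (dBA _ _ su sv) opprD addrACA.
Qed.

Lemma additive_opM : additive_op (opM V).
Proof.
split=> [u su|u v _ _]; first exact: (smoothM sV su).
exact: (mulrDr (V : 'rV[R]_n -> R[i])).
Qed.

Lemma additive_H0 : additive_op (@H0 R n).
Proof. by split=> [u su|u v su sv]; [exact: smooth_H0|exact: H0D]. Qed.

Lemma additive_VJ J : additive_op (VJ V J).
Proof.
elim/last_ind: J => [|J a IH]; first by split.
rewrite /VJ -cats1 foldl_cat /=; elim: a => [|a IHa].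
  exact: additive_opC IH additive_opM.
exact: additive_op_comm additive_H0 IHa.
Qed.

Lemma VJ_rcons0 J u : VJ V (rcons J 0) u = VJ V J (V * u).
Proof. by rewrite /VJ -cats1 foldl_cat. Qed.

Lemma VJ_rconsS J a u : VJ V (rcons J a.+1) u =
  H0 (VJ V (rcons J a) u) - VJ V (rcons J a) (H0 u).
Proof. by rewrite /VJ -!cats1 !foldl_cat. Qed.

Lemma VopE j u :
  Vop V j u = \sum_(J <- norm_seqs j) cst ((-1) ^+ sumn J) * VJ V J u.
Proof.
apply/funext => x; rewrite fct_sumE.
rewrite -(sum_norm_seqs (fun J => (-1) ^+ sumn J * VJ V J u x)).
by [].
Qed.

Lemma VopD j u v : smooth u -> smooth v -> Vop V j (u + v) = Vop V j u + Vop V j v.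
Proof.
move=> su sv; rewrite !VopE -big_split/=; apply: eq_bigr => J _.
by rewrite (additive_VJ J).2// -mulrDr.
Qed.

Lemma Vop0 u : Vop V 0 u = u.
Proof.
rewrite VopE (perm_big [:: [::]]) ?big_seq1 /=.
  by apply/funext => x; exact: mul1r.
apply: uniq_perm => //; first exact: norm_seqs_uniq.
by move=> [|a J]; rewrite mem_norm_seqs// /vnorm /= addnS.
Qed.

Lemma VopS j u : smooth u ->
  Vop V j.+1 u = Vop V j (V * u) + (Vop V j (H0 u) - H0 (Vop V j u)).
Proof.
move=> su; have sVJ J := (additive_VJ J).1 u su.
rewrite !VopE (perm_big _ (norm_seqsS j)) big_cat !big_map big_filter /=.
congr (_ + _).
  by apply: eq_bigr => J _; rewrite VJ_rcons0 -cats1 sumn_cat addn0.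
rewrite (H0_sum _ (fun J _ => smoothM (smooth_cst n _) (sVJ J))) -sumrB.
(* The empty word can be added to the second sum: V_J is then the identity,
   which commutes with H0. *)
rewrite big_mkcond; apply: eq_bigr => J _; rewrite (H0Z _ (sVJ J)).
case/lastP: J => [|J a]; first by rewrite /= subrr.
rewrite -size_eq0 size_rcons /= bump_last_rcons VJ_rconsS.
have -> : sumn (rcons J a.+1) = (sumn (rcons J a)).+1.
  by rewrite -!cats1 !sumn_cat /= !addn0 addnS.
rewrite exprS mulN1r (_ : cst (- _) = - cst ((-1) ^+ sumn (rcons J a)))//.
by rewrite mulNr -mulrN opprB -mulrBr.
Qed.

Lemma smooth_H u : smooth u -> smooth (H V u).
Proof. by move=> su; exact: (smoothD (smooth_H0 su) (smoothM sV su)). Qed.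

Lemma VopS_H j u : smooth u -> Vop V j.+1 u = Vop V j (H V u) - H0 (Vop V j u).
Proof.
move=> su; rewrite VopS// addrA -(VopD j (smoothM sV su) (smooth_H0 su)).
by rewrite (addrC (V * u)).
Qed.

Lemma smooth_iter A k u : (forall v, smooth v -> smooth (A v)) -> smooth u ->
  smooth (iter k A u).
Proof. by move=> sA su; elim: k => [|k IH]; [exact: su|exact: sA IH]. Qed.

Lemma Vop_binomial j u : smooth u ->
  Vop V j u = \sum_(k < j.+1) cst ((-1) ^+ k * 'C(j, k)%:R) *
     iter k (@H0 R n) (iter (j - k) (H V) u).
Proof.
elim: j u => [|j IH] u su.
  rewrite Vop0 big_ord1 /= bin0 mulr1; apply/esym/funext => x; exact: mul1r.
pose T k := iter k (@H0 R n) (iter (j.+1 - k) (H V) u).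
pose c k : R[i] := (-1) ^+ k * 'C(j, k)%:R.
have sT k l : smooth (iter k (@H0 R n) (iter l (H V) u)).
  by apply: smooth_iter; [exact: smooth_H0|apply: smooth_iter; [exact: smooth_H|]].
rewrite VopS_H// (IH _ (smooth_H su)) (IH _ su).
rewrite (H0_sum _ (fun (k : 'I_j.+1) _ =>
  smoothM (smooth_cst n _) (sT k (j - k)%N))).
under [X in _ - X]eq_bigr => k _ do rewrite (H0Z _ (sT k (j - k)%N)).
transitivity (\sum_(k < j.+1) cst (c k) * T k - \sum_(k < j.+1) cst (c k) * T k.+1).
  congr (_ - _); apply: eq_bigr => k _; rewrite /T ?subSS//.
  by rewrite -iterSr -subSn// -ltnS.
(* Both sums are brought to the same range, so that Pascal's rule applies
   termwise after splitting off k = 0. *)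
have -> : \sum_(k < j.+1) cst (c k) * T k = \sum_(k < j.+2) cst (c k) * T k.
  rewrite [RHS]big_ord_recr /= {3}/c bin_small// mulr0.
  by rewrite (_ : cst 0 = 0)// mul0r addr0.
rewrite big_ord_recl [RHS]big_ord_recl -addrA; congr (_ + _).
  by rewrite /c !bin0.
rewrite -sumrB; apply: eq_bigr => k _; rewrite -/(T _) -mulrBl; congr (_ * _).
apply/funext => x; rewrite -[LHS]/(c k.+1 - c k) /c /= /bump /= add1n binS natrD mulrDr.
by congr (_ + _); rewrite exprS mulN1r mulNr.
Qed.

(** The composition with V contributes S^(-eps (j + 1) - eps) at order j, the
    commutator S^(-eps (j + 1) - 1) at order j + 1; both are contained in
    S^(-eps (j + 2)) because eps <= 1. *)
Lemma symbol_op_Vop eps j : eps <= 1 -> symbol (- eps) V ->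
  symbol_op (- (eps * j.+1%:R)) j (Vop V j.+1).
Proof.
move=> e1 SV; elim: j => [|j IH].
  rewrite mulr1; apply: symbol_op_ext (symbol_op_term (s := [::]) SV (leqnn 0)) => u su.
  by rewrite (VopS 0 su) !Vop0 subrr addr0.
apply: (symbol_op_ext (B := fun u =>
  Vop V j.+1 (V * u) + comm (Vop V j.+1) (@H0 R n) u)).
  by move=> u su; rewrite VopS.
apply: symbol_opD.
  apply: symbol_opW (symbol_op_mulr SV IH) => //.
  by rewrite -[in leRHS]natr1 mulrDr mulr1 opprD.
apply: symbol_opW (symbol_op_comm_H0 IH) => //.
by rewrite -[in leRHS]natr1 mulrDr mulr1 opprD lerD2l lerN2.
Qed.

End Vop.

Theorem proposition4p1 (R : realType) (n : nat) (hn : (1 <= n)%N)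
    (eps : R) (heps : 0 < eps <= 1)
    (V : 'rV[R]_n -> R[i]) (hV : symbol (- eps) V)
    (hVreal : forall x : 'rV[R]_n, complex.Im (V x) = 0) :
  [/\ op_eq (Vop V 0) id,
      forall j : nat, (1 <= j)%N ->
        op_eq (Vop V j) (opD (opC (Vop V j.-1) (opM V)) (comm (Vop V j.-1) (@H0 R n))),
      forall j : nat,
        op_eq (Vop V j)
          (fun u x => \sum_(k < j.+1) (-1) ^+ k * 'C(j, k)%:R *
             iter k (@H0 R n) (iter (j - k) (H V) u) x)
    & forall j : nat, (1 <= j)%N ->
        exists p : {ffun 'I_n -> 'I_j} -> ('rV[R]_n -> R[i]),
          (forall nu : {ffun 'I_n -> 'I_j}, (mlen (fun i => nu i) <= j.-1)%N ->
             symbol (- (eps * j%:R)) (p nu)) /\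
          (* |nu| <= j - 1 forces every entry of nu to be < j *)
          op_eq (Vop V j)
            (fun u x => \sum_(nu : {ffun 'I_n -> 'I_j} | (mlen (fun i => nu i) <= j.-1)%N)
               p nu x * mpartial (fun i => nu i) u x)].
Proof.
have sV := symbol_smooth hV.
have evalE (f g : 'rV[R]_n -> R[i]) : f = g -> forall x, f x = g x by move=> ->.
split=> [u su x|[//|j] _ u su|j u su x|[//|j] _].
- by rewrite Vop0.
- by apply: evalE; rewrite (VopS sV j su).
- by rewrite (Vop_binomial sV j su) fct_sumE.
- have [p [sp Vp]] := symbol_op_Vop sV j (andP heps).2 hV.
  exists p; split=> [nu _|u su x]; first exact: sp.
  by rewrite (Vp u su) fct_sumE.
Qed.
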